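(* Suppose $N>M>2$, $0<\alpha<1$, let $\vec w=(w_1,\dots,w_N)$ be a weight vector with positive entries summing to $1$, and suppose that $C_i(\alpha)>0$ for every $i\in[N]$, where $$C_i(\alpha)=\left|\left\{\mathcal{M}\subseteq[N]:\ |\mathcal{M}|=M,\ i\in\mathcal{M},\ \sum_{m\in\mathcal{M}}w_m\ge\alpha\right\}\right|.$$ If one sets $$p_i=\frac{w_i/C_i(\alpha)}{\sum_{j=1}^N w_j/C_j(\alpha)},\qquad i\in[N],$$ then the sortition algorithm Weighted Rejection Sampling with these $p_i$ is fair, i.e. $\mathbb{E}[g(n;\mathcal{M})]=w_n$ for all $n\in[N]$.
   Context: Setting: there are $N$ participants, indexed by $[N]=\{1,\dots,N\}$, with positive weights $w_i$, $\sum_i w_i=1$. A sortition algorithm outputs a random committee $\mathcal{M}\subseteq[N]$ of size $M$ and unnormalized weights $g_n$; the voting power is $g(n;\mathcal{M})=g_n/\sum_{m\in\mathcal{M}}g_m$ for $n\in\mathcal{M}$ and $g(n;\mathcal{M})=0$ for $n\notin\mathcal{M}$. The algorithm is fair (on $\vec w$) if $\mathbb{E}[g(n;\mathcal{M})]=w_n$ for all $n\in[N]$. Algorithm Weighted Rejection Sampling (input $\vec w$, $M$, $\alpha$): (1) compute the numbers $p_i$; (2) generate a uniformly random $M$-element subset $\mathcal{M}=\{m_1,\dots,m_M\}$ of $[N]$; (3) generate an independent $U$ uniform on $[0,1]$; if $U\ge\left(\sum_{j=1}^M p_{m_j}\right)\cdot\mathbf{1}\left(\sum_{j=1}^M w_{m_j}\ge\alpha\right)$,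 reject $\mathcal{M}$ and return to step (2) with fresh independent randomness; (4) otherwise output $\mathcal{M}$ with $g_m=p_m$ for $m\in\mathcal{M}$ and $g_m=0$ for $m\notin\mathcal{M}$. *)

(* Defs.v *)
From HB Require Import structures.
From mathcomp Require Import all_boot all_order all_algebra finmap.
From mathcomp Require Import all_classical all_reals all_analysis.

Set Implicit Arguments.
Unset Strict Implicit.
Unset Printing Implicit Defensive.

Import Order.TTheory GRing.Theory Num.Theory.

Local Open Scope classical_set_scope.
Local Open Scope ring_scope.

HB.instance Definition _ (T : finType) := isPointed.Build {set T} finset.set0.

HB.instance Definition _ (T : finType) :=
  @isMeasurable.Build default_measure_display {set T}
    discrete_measurable discrete_measurable0
    discrete_measurableC discrete_measurableU.

Definition mutually_independent (d : measure_display) (Omega : measurableType d)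
    (R : realType) (P : probability Omega R)
    (I : choiceType) (F : I -> set (set Omega)) : Prop :=
  forall (J : {fset I}) (E : I -> set Omega),
    (forall i, i \in J -> F i (E i)) ->
    P (\bigcap_(i in [set` J]) E i) = (\prod_(i <- J) P (E i))%E.

Definition sigma_of (d d' : measure_display) (Omega : measurableType d)
    (T : measurableType d') (X : Omega -> T) : set (set Omega) :=
  preimage_set_system setT X measurable.

Definition uniform_committee (d : measure_display) (Omega : measurableType d)
    (R : realType) (P : probability Omega R) (N M : nat)
    (S : {RV P >-> {set 'I_N}}) : Prop :=
  forall A : {set 'I_N},
    distribution P S [set A] =
      (if #|A| == M then ('C(N, M)%:R^-1)%:E else 0%E).

Definition uniform01 (d : measure_display) (Omega : measurableType d)
    (R : realType) (P : probability Omega R) (U : {RV P >-> R}) : Prop :=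
  forall B : set R, measurable B ->
    distribution P U B = uniform_prob (@ltr01 R) B.

(* [S k] and [U k] are the committee and the uniform variable drawn in the
   k-th pass of the rejection loop; all draws of all passes are independent. *)
Definition rejection_draws (d : measure_display) (Omega : measurableType d)
    (R : realType) (P : probability Omega R) (N M : nat)
    (S : nat -> {RV P >-> {set 'I_N}}) (U : nat -> {RV P >-> R}) : Prop :=
  [/\ forall k, uniform_committee M (S k),
      forall k, uniform01 (U k) &
      mutually_independent P (fun i : nat + nat =>
        match i with
        | inl k => sigma_of (S k)
        | inr k => sigma_of (U k)
        end)].

(* A committee together with its unnormalized weights. *)
Definition sortition_output (R : realType) (N : nat) : Type :=
  ({set 'I_N} * ('I_N -> R))%type.

Definition voting_power (R : realType) (N : nat)
    (o : sortition_output R N) (n : 'I_N) : R :=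
  if n \in o.1 then o.2 n / \sum_(m in o.1) o.2 m else 0.

(* [None] stands for a run that never outputs a committee; such a run
   contributes no voting power. As voting powers sum to at most 1 over n,
   fairness for weights summing to 1 forces [None] to have probability 0. *)
Definition fair (d : measure_display) (Omega : measurableType d)
    (R : realType) (P : probability Omega R) (N : nat)
    (w : 'I_N -> R) (out : Omega -> option (sortition_output R N)) : Prop :=
  forall n : 'I_N,
    ('E_P[fun omega => if out omega is Some o then voting_power o n else 0%R]
      = (w n)%:E)%E.

Definition accepts (R : realType) (N : nat) (w : 'I_N -> R) (alpha : R)
    (p : 'I_N -> R) (A : {set 'I_N}) (u : R) : bool :=
  ~~ ((\sum_(m in A) p m) * (alpha <= \sum_(m in A) w m)%R%:R <= u).

(* The output of the rejection loop on the successive draws [s k], [u k]. *)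
Definition weighted_rejection_sampling (R : realType) (N : nat)
    (w : 'I_N -> R) (alpha : R) (p : 'I_N -> R)
    (s : nat -> {set 'I_N}) (u : nat -> R) : option (sortition_output R N) :=
  match pselect (exists k, accepts w alpha p (s k) (u k)) with
  | left ex =>
      let A := s (ex_minn ex) in
      Some (A, fun m => if m \in A then p m else 0)
  | right _ => None
  end.

Definition committee_count (R : realType) (N M : nat) (w : 'I_N -> R)
    (alpha : R) (i : 'I_N) : nat :=
  #|[set A : {set 'I_N} |
      [&& #|A| == M, i \in A & alpha <= \sum_(m in A) w m]]%SET|.

Definition rejection_weights (R : realType) (N M : nat) (w : 'I_N -> R)
    (alpha : R) (i : 'I_N) : R :=
  (w i / (committee_count M w alpha i)%:R)
    / \sum_(j < N) w j / (committee_count M w alpha j)%:R.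

(* Main.v *)
(* One pass of the loop accepts the committee A with probability c q(A), where
   c = 1 / 'C(N, M) and q(A) is the sum of the p_m over m in A if A is heavy
   enough and 0 otherwise. Passes being independent, summing the geometric
   series over the index of the accepting pass shows that A is output with
   probability c q(A) / a, where a is the sum of all c q(B). The factor q(A)
   cancels the denominator of the voting power, so that the expected voting
   power of n is c p_n C_n / a. With Z the sum of the w_j / C_j, one has
   p_n C_n = w_n / Z, hence a = c / Z after exchanging sums, and the expected
   power is w_n. *)
Require Import Defs.
From mathcomp Require Import all_boot all_order all_algebra finmap.
From mathcomp Require Import all_classical all_reals all_analysis.
From mathcomp Require Import ring lra.

Import Order.TTheory GRing.Theory Num.Theory numFieldNormedType.Exports.
Local Open Scope ring_scope.

(** * Uniform law on the unit interval and total probability *)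

Lemma uniform_prob01_lt (R : realType) (t : R) : 0 <= t <= 1 ->
  uniform_prob (@ltr01 R) [set u | u < t]%classic = t%:E.
Proof.
move=> /andP[t0 t1]; rewrite /uniform_prob integral_uniform_pdf.
have -> : ([set u | u < t] `&` `[0, 1])%classic = `[0, t[%classic :> set R.
  apply/seteqP; split => u /=; rewrite !in_itv/=.
    by move=> [-> /andP[->]].
  move=> /andP[-> ut]; split => //=.
  by apply: ltW; exact: lt_le_trans t1.
rewrite (eq_integral (cst 1%:E)); last first.
  move=> u; rewrite inE/= in_itv/= /uniform_pdf => /andP[-> ut].
  by rewrite (ltW (lt_le_trans ut t1)) subr0 invr1.
rewrite integral_cst//= mul1e lebesgue_measure_itv/= lte_fin.
(* The length of [[0, t[] is given by cases on [0 < t]; the other case is [t = 0]. *)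
case: ifPn => [_|]; first by rewrite oppr0 adde0.
by rewrite -leNgt => /(conj t0)/andP/le_anti <-.
Qed.

(** The indicator of [G] is the finite sum of the indicators of its pieces, since exactly one piece
    can contain a given point of [G]; integrating gives the claim. This is what allows conditioning
    on the committee drawn in a pass. *)
Lemma probability_partition (d : measure_display) (Omega : measurableType d)
    (R : realType) (P : probability Omega R) (T : finType) (X : Omega -> T)
    (G : set Omega) :
    (forall t, measurable (G `&` [set o | X o = t])%classic) ->
  P G = (\sum_(t : T) P (G `&` [set o | X o = t])%classic)%E.
Proof.
move=> mGX.
have GE o : \1_G o = \sum_(t : T) \1_(G `&` [set o | X o = t])%classic o :> R.
  rewrite (bigD1 (X o)) //= big1 => [|t tX].
    by rewrite addr0 !indicE in_setI [X in _ && X]mem_set// andbT.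
  rewrite indicE memNset// => -[_ /= oX].
  by rewrite oX eqxx in tX.
have mG : measurable G.
  rewrite (_ : G = \bigcup_(t in [set: T]) (G `&` [set o | X o = t]))%classic.
    by apply: fin_bigcup_measurable.
  apply/seteqP; split => [x Gx|x [t _ []]] //.
  by exists (X x).
have := @integral_indic _ _ _ P setT measurableT G mG.
rewrite setIT => <-.
under eq_integral do rewrite GE -sumEFin.
rewrite integral_sum//; last by move=> t; apply: integrable_indic.
by apply: eq_bigr => t _; rewrite integral_indic// setIT.
Qed.

(** * Law of the output of the rejection loop, for an abstract acceptance probability [q] *)

Section RejectionLoop.
Context (d : measure_display) (Omega : measurableType d) (R : realType)
  (P : probability Omega R) (N M : nat) (S : nat -> {RV P >-> {set 'I_N}})
  (U : nat -> {RV P >-> R}) (hSU : rejection_draws M S U)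
  (q : {set 'I_N} -> R) (hq : forall A, 0 <= q A <= 1).

Local Open Scope classical_set_scope.

Let F (i : nat + nat) : set (set Omega) :=
  match i with inl k => sigma_of (S k) | inr k => sigma_of (U k) end.

Let pass (i : nat + nat) : nat := match i with inl k => k | inr k => k end.

Definition uniform_pmf (A : {set 'I_N}) : R :=
  if #|A| == M then ('C(N, M)%:R)^-1 else 0.

(** The probability that a single pass accepts, [q A] being the conditional probability of accepting
    once [A] is drawn. *)
Definition acceptance_rate : R := \sum_A uniform_pmf A * q A.

Definition all_rejected (k : nat) : set Omega :=
  [set x | forall i, (i < k)%N -> q (S i x) <= U i x].

Definition first_accepted (A : {set 'I_N}) (k : nat) : set Omega :=
  all_rejected k `&` [set x | S k x = A /\ U k x < q A].

Let measurable_preimage (d' : measure_display) (T : measurableType d')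
  (X : {RV P >-> T}) (B : set T) : measurable B -> measurable (X @^-1` B).
Proof.
by move=> mB; rewrite -[X in measurable X]setTI; exact: (measurable_funP X).
Qed.

Let measurable_committee (B : set {set 'I_N}) : measurable B.
Proof. exact: I. Qed.

Let measurable_draw (k : nat) (A : {set 'I_N}) :
  measurable [set x | S k x = A].
Proof. exact: (@measurable_preimage _ _ (S k) [set A]). Qed.

Let measurable_lt (t : R) : measurable [set u : R | u < t].
Proof.
rewrite (_ : [set u | u < t] = `]-oo, t[); first exact: measurable_itv.
by apply/seteqP; split => u /=; rewrite in_itv.
Qed.

Let measurable_ge (t : R) : measurable [set u : R | t <= u].
Proof.
rewrite (_ : [set u | t <= u] = `[t, +oo[); first exact: measurable_itv.
by apply/seteqP; split => u /=; rewrite in_itv/= andbT.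
Qed.

Lemma sigma_of_measurable (d' : measure_display) (T : measurableType d')
  (X : {RV P >-> T}) (E : set Omega) : sigma_of X E -> measurable E.
Proof. by move=> [B mB <-]; rewrite setTI; exact: measurable_preimage. Qed.

Lemma sigma_of_preimage (d' : measure_display) (T : measurableType d')
  (X : Omega -> T) (B : set T) : measurable B -> sigma_of X (X @^-1` B).
Proof. by move=> mB; exists B => //; rewrite setTI. Qed.

Lemma committee_prob (k : nat) (A : {set 'I_N}) :
  P (S k @^-1` [set A]) = (uniform_pmf A)%:E.
Proof.
by case: hSU => uS _ _; rewrite (uS k A : P _ = _) /uniform_pmf; case: ifP.
Qed.

Lemma accept_prob (k : nat) (t : R) : 0 <= t <= 1 ->
  P (U k @^-1` [set u | u < t]) = t%:E.
Proof.
move=> t01; case: hSU => _ uU _.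
by have := uU k _ (measurable_lt t); rewrite uniform_prob01_lt.
Qed.

Lemma reject_prob (k : nat) (t : R) : 0 <= t <= 1 ->
  P (U k @^-1` [set u | t <= u]) = (1 - t)%:E.
Proof.
move=> t01; rewrite EFinB -(accept_prob k t t01) -probability_setC.
  congr (P _); apply/seteqP; split => x /=; first by rewrite leNgt => /negP.
  by move=> /negP; rewrite -leNgt.
by apply: measurable_preimage; exact: measurable_lt.
Qed.

(** The values form the law of the committee of pass 0, so they add up to the total mass; no subsets
    are counted. *)
Lemma sum_uniform_pmf : \sum_A uniform_pmf A = 1.
Proof.
apply: EFin_inj; rewrite -(probability_setT P).
rewrite (probability_partition _ _ _ _ _ (S 0)).
  by rewrite -sumEFin; apply: eq_bigr => A _; rewrite setTI -(committee_prob 0).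
by move=> A; rewrite setTI; exact: measurable_draw.
Qed.

Lemma measurable_all_rejected (k : nat) : measurable (all_rejected k).
Proof.
rewrite (_ : all_rejected k =
    \bigcap_(i in `I_k) [set x | q (S i x) <= U i x]); last by [].
apply: fin_bigcap_measurable => // i _.
rewrite -[X in measurable X]setTI; apply: measurable_fun_le => //.
by apply: measurableT_comp => // _ B _; exact: I.
Qed.

(* Rejections are handled through an arbitrary family of events about passes
   k and later: this makes the induction on k go through, by conditioning on
   the committee drawn in pass k and moving the two draws of that pass into the
   family. *)
Lemma all_rejected_indep (k : nat) (J : {fset nat + nat})
    (E : nat + nat -> set Omega) :
    (forall i, i \in J -> F i (E i)) ->
    (forall i, i \in J -> (k <= pass i)%N) ->
  P (all_rejected k `&` \bigcap_(i in [set` J]) E i) =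
  (((1 - acceptance_rate) ^+ k)%:E * P (\bigcap_(i in [set` J]) E i))%E.
Proof.
elim: k J E => [|k IHk] J E FE kJ.
  rewrite expr0 mul1e (_ : all_rejected 0 = setT) ?setTI//.
  by apply/seteqP; split.
(* [J] only concerns passes from [k.+1] on, so both draws of pass [k] are new to it and contribute
   separate factors to the product. *)
have kNJl : inl k \notin J by apply/negP => /kJ; rewrite /= ltnn.
have kNJr : inr k \notin J by apply/negP => /kJ; rewrite /= ltnn.
have kNJ : inl k \notin (inr k |` J)%fset by rewrite in_fset1U /= (negbTE kNJl).
have mJ : measurable (\bigcap_(i in [set` J]) E i).
  apply: fin_bigcap_measurable => // i /= iJ.
  by move: (FE i iJ); case: (i) => ?; exact: sigma_of_measurable.
have [c Pc] : exists c, P (\bigcap_(i in [set` J]) E i) = c%:E.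
  exists (fine (P (\bigcap_(i in [set` J]) E i))).
  by rewrite fineK ?fin_num_measure.
rewrite (probability_partition _ _ _ _ _ (S k)); last first.
  move=> B; apply: measurableI.
    by apply: measurableI => //; exact: measurable_all_rejected.
  by exact: measurable_draw.
transitivity (\sum_B ((1 - acceptance_rate) ^+ k *
    (uniform_pmf B * ((1 - q B) * c)))%:E)%E.
  apply: eq_bigr => B _.
  (* The enlarged family: in pass [k] the committee is [B] and the uniform variable rejects it;
     nothing changes on [J]. *)
  pose E' (i : nat + nat) := if i == inl k then S k @^-1` [set B]
    else if i == inr k then U k @^-1` [set u | q B <= u] else E i.
  have E'E : \bigcap_(i in [set` J]) E' i = \bigcap_(i in [set` J]) E i.
    apply: eq_bigcapr => i /= iJ; rewrite /E'.
    case: eqP => [ik|_]; first by rewrite -ik iJ in kNJl.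
    by case: eqP => [ik|//]; rewrite -ik iJ in kNJr.
  have E'l : E' (inl k) = S k @^-1` [set B] by rewrite /E' eqxx.
  have E'r : E' (inr k) = U k @^-1` [set u | q B <= u] by rewrite /E' /= eqxx.
  have FE' i : i \in (inl k |` (inr k |` J))%fset -> F i (E' i).
    rewrite !in_fset1U => /or3P[/eqP->|/eqP->|iJ].
    - by rewrite E'l; exact: sigma_of_preimage.
    - by rewrite E'r; apply: sigma_of_preimage; exact: measurable_ge.
    - rewrite /E'; case: eqP => [ik|_]; first by rewrite -ik iJ in kNJl.
      case: eqP => [ik|_]; first by rewrite -ik iJ in kNJr.
      exact: FE.
  (* Once the committee is fixed to [B], the threshold [q (S k x)] is the constant [q B], so
     rejection in pass [k] becomes an event about [U k] alone. *)
  have -> : all_rejected k.+1 `&` \bigcap_(i in [set` J]) E i `&`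
      [set x | S k x = B] = all_rejected k `&`
      \bigcap_(i in [set` (inl k |` (inr k |` J))%fset]) E' i.
    rewrite !bigcap_fsetU1 E'E E'l E'r; apply/seteqP; split => x /=.
      move=> [[rx Jx] SB]; split; first by move=> i ik; apply: rx; exact: ltnW.
      by do !split => //; rewrite -SB; apply: rx.
    move=> [rx [SB [UB Jx]]]; do !split => //.
    move=> i; rewrite ltnS leq_eqVlt => /predU1P[->|]; first by rewrite SB.
    exact: rx.
  have [_ _ indep] := hSU.
  rewrite IHk //; last first.
    move=> i; rewrite !in_fset1U => /or3P[/eqP->|/eqP->|/kJ] //.
    exact: ltnW.
  have PJ : P (\bigcap_(i in [set` J]) E i) = (\prod_(i <- J) P (E' i))%E.
    rewrite -E'E; apply: indep => i iJ; apply: FE'.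
    by rewrite !in_fset1U iJ !orbT.
  rewrite (indep _ E' FE') !big_fsetU1 //= -PJ E'l E'r committee_prob.
  by rewrite reject_prob // Pc -!EFinM.
rewrite Pc sumEFin -EFinM; congr (_%:E).
rewrite -mulr_sumr exprSr -mulrA; congr (_ * _).
(* Averaging [1 - q B] over the uniform committee gives the rejection probability of one pass, the
   extra factor in the power [k.+1]. *)
transitivity ((\sum_B (uniform_pmf B - uniform_pmf B * q B)) * c).
  by rewrite mulr_suml; apply: eq_bigr => B _; ring.
by rewrite sumrB sum_uniform_pmf.
Qed.

(** The previous lemma applies with the two draws of pass [k] as the family of later events. *)
Lemma first_accepted_prob (A : {set 'I_N}) (k : nat) :
  P (first_accepted A k) =
  ((1 - acceptance_rate) ^+ k * (uniform_pmf A * q A))%:E.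
Proof.
pose E (i : nat + nat) := if i == inl k then S k @^-1` [set A]
  else U k @^-1` [set u | u < q A].
have El : E (inl k) = S k @^-1` [set A] by rewrite /E eqxx.
have Er : E (inr k) = U k @^-1` [set u | u < q A] by [].
have FE i : i \in [fset inl k; inr k]%fset -> F i (E i).
  rewrite !inE => /orP[/eqP->|/eqP->].
    by rewrite El; exact: sigma_of_preimage.
  by rewrite Er; apply: sigma_of_preimage; exact: measurable_lt.
have -> : first_accepted A k =
    all_rejected k `&` \bigcap_(i in [set` [fset inl k; inr k]%fset]) E i.
  congr (_ `&` _); apply/seteqP; split => x /=.
    by move=> [SA UA] i; rewrite /= !inE => /orP[/eqP->|/eqP->]; rewrite ?El ?Er.
  move=> EX; split.
    by have := EX (inl k); rewrite El; apply; rewrite /= !inE eqxx.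
  by have := EX (inr k); rewrite Er; apply; rewrite /= !inE eqxx orbT.
rewrite all_rejected_indep //; last first.
  by move=> i; rewrite !inE => /orP[/eqP->|/eqP->].
have [_ _ indep] := hSU.
rewrite (indep _ E FE) big_fsetU1 ?inE //= big_seq_fset1 El Er.
by rewrite committee_prob accept_prob // -!EFinM.
Qed.

Lemma measurable_first_accepted (A : {set 'I_N}) (k : nat) :
  measurable (first_accepted A k).
Proof.
apply: measurableI; first exact: measurable_all_rejected.
apply: (@measurableI _ _ (S k @^-1` [set A]) (U k @^-1` [set u | u < q A])).
  by exact: measurable_draw.
by apply: measurable_preimage; exact: measurable_lt.
Qed.

(** The events for different [k] are disjoint, and their probabilities form a geometric series of
    ratio [1 - acceptance_rate], which lies in [[0, 1[]. *)
Lemma accepted_prob (A : {set 'I_N}) : 0 < acceptance_rate ->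
  P (\bigcup_k first_accepted A k) =
  (uniform_pmf A * q A / acceptance_rate)%:E.
Proof.
move=> a0; have a1 : acceptance_rate <= 1.
  rewrite -sum_uniform_pmf; apply: ler_sum => B _.
  have /andP[_ qB1] := hq B; rewrite ler_piMr // /uniform_pmf.
  by case: ifP => // _; rewrite invr_ge0.
rewrite measure_bigcup //; last 2 first.
- by move=> k _; exact: measurable_first_accepted.
(* A first acceptance at the later pass [j] includes a rejection at pass [i]. *)
- apply/trivIsetP => i j _ _; wlog ij : i j / (i < j)%N => [W|_].
    rewrite neq_ltn => /orP[ij|ji]; first by apply: W => //; rewrite ltn_eqF.
    by rewrite setIC; apply: W => //; rewrite ltn_eqF.
  apply/seteqP; split => x // -[[_ [SA UA]] [rx _]].
  by have := rx i ij; rewrite SA leNgt UA.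
rewrite (eq_eseriesr (fun k _ => first_accepted_prob A k)).
rewrite (_ : (fun n => _) = EFin \o
  series (geometric (uniform_pmf A * q A) (1 - acceptance_rate))); last first.
  apply/funext => n /=; rewrite /series /= -sumEFin big_mkcond.
  apply: eq_bigr => k _; rewrite in_setT mulrC //.
have r1 : `|1 - acceptance_rate| < 1 by rewrite ger0_norm; lra.
have cv := @cvg_geometric_series R (uniform_pmf A * q A) _ r1.
rewrite EFin_lim; last exact: is_cvg_geometric_series.
by rewrite (cvg_lim _ cv) // opprB addrC subrK.
Qed.

End RejectionLoop.

(** * Double counting and the expected voting power *)

(** After exchanging the sums, each [m] is met once per heavy committee containing it. With [D]
    always true this computes the acceptance rate; with [D] singling out [n], the expected power of
    [n]. *)
Lemma sum_committee (R : realType) (N M : nat) (w p : 'I_N -> R) (alpha : R)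
    (D : pred 'I_N) :
  \sum_(A : {set 'I_N} | (#|A| == M) && (alpha <= \sum_(m in A) w m))
     \sum_(m in A | D m) p m =
  \sum_(m | D m) p m *+ committee_count M w alpha m.
Proof.
rewrite (exchange_big_dep D) /=; last by move=> A m _ /andP[].
apply: eq_bigr => m Dm; rewrite /committee_count -sumr_const.
by apply: eq_bigl => A; rewrite inE Dm andbT -andbA [_ && (m \in A)]andbC.
Qed.

Theorem proposition4p5 (R : realType) (N M : nat) (w : 'I_N -> R) (alpha : R)
    (hM : (2 < M)%N) (hMN : (M < N)%N)
    (halpha0 : 0 < alpha) (halpha1 : alpha < 1)
    (hw_pos : forall i, 0 < w i) (hw_sum : \sum_(i < N) w i = 1)
    (hC : forall i, (0 < committee_count M w alpha i)%N)
    (d : measure_display) (Omega : measurableType d) (P : probability Omega R)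
    (S : nat -> {RV P >-> {set 'I_N}}) (U : nat -> {RV P >-> R})
    (hSU : rejection_draws M S U) :
  fair P w (fun omega =>
    weighted_rejection_sampling w alpha (rejection_weights M w alpha)
      (fun k => S k omega) (fun k => U k omega)).
Proof.
set p := rejection_weights M w alpha.
pose C i : R := (committee_count M w alpha i)%:R.
have C0 i : 0 < C i by rewrite ltr0n.
pose Z := \sum_(j < N) w j / C j.
have N0 : (0 < N)%N by exact: leq_trans hMN.
have Z0 : 0 < Z.
  rewrite /Z (bigD1 (Ordinal N0)) //= ltr_pwDl ?divr_gt0 //.
  by apply: sumr_ge0 => i _; rewrite divr_ge0 // ltW.
have pC i : p i *+ committee_count M w alpha i = w i / Z.
  rewrite -mulr_natr /p /rejection_weights -/(C i) -/Z.
  by field; rewrite !gt_eqF // ltr0n.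
have p0 i : 0 < p i by rewrite /p /rejection_weights !divr_gt0 // ltr0n.
have p1 : \sum_i p i = 1 by rewrite -mulr_suml divff // gt_eqF.
pose good (A : {set 'I_N}) := alpha <= \sum_(m in A) w m.
pose q (A : {set 'I_N}) := (\sum_(m in A) p m) * (good A)%:R.
(* The [p i] are positive with sum 1, so a partial sum is a genuine probability and can serve as
   threshold for a uniform variable. *)
have hq A : 0 <= q A <= 1.
  have pA : 0 <= \sum_(m in A) p m by apply: sumr_ge0 => m _; exact: ltW.
  rewrite /q mulr_ge0 //=; apply: (@le_trans _ _ (\sum_(m in A) p m)).
    by rewrite ler_piMr // lern1 leq_b1.
  rewrite -p1 [leRHS](bigID (mem A)) /= lerDl.
  by apply: sumr_ge0 => m _; exact: ltW.
pose c : R := ('C(N, M)%:R)^-1.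
have c0 : 0 < c by rewrite invr_gt0 ltr0n bin_gt0 ltnW.
have rateE : acceptance_rate R N M q = c / Z.
  rewrite /acceptance_rate.
  transitivity (c * \sum_(A : {set 'I_N} | (#|A| == M) && good A)
      \sum_(m in A | true) p m).
    rewrite mulr_sumr [RHS]big_mkcond; apply: eq_bigr => A _.
    rewrite /uniform_pmf /q; case: (#|A| == M); last by rewrite mul0r.
    case: (good A) => /=; last by rewrite !mulr0.
    by rewrite mulr1; congr (_ * _); apply: eq_bigl => m; rewrite andbT.
  rewrite sum_committee; under eq_bigr do rewrite pC.
  by rewrite -mulr_suml hw_sum mul1r.
have a0 : 0 < acceptance_rate R N M q by rewrite rateE divr_gt0.
(* [E A] is the event that the loop outputs [A]. *)
pose E A := (\bigcup_k first_accepted _ _ _ _ _ S U q A k)%classic.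
have mE A : measurable (E A).
  by apply: bigcup_measurable => k _; exact: measurable_first_accepted.
move=> n.
pose v (A : {set 'I_N}) : R :=
  voting_power (A, fun m => if m \in A then p m else 0) n.
(* The events [E A] are disjoint and cover exactly the runs that stop; on the other runs both sides
   are 0. The expectation thus becomes a finite sum of probabilities. *)
have outE x : (if weighted_rejection_sampling w alpha p
      (fun k => S k x) (fun k => U k x) is Some o then voting_power o n else 0)
    = \sum_A v A * \1_(E A) x.
  rewrite /weighted_rejection_sampling; case: pselect => [ex|nex]; last first.
    rewrite big1 // => A _; rewrite indicE memNset ?mulr0 //.
    move=> [k _ [_ [SA UA]]]; apply: nex; exists k.
    by rewrite /accepts SA -ltNge.
  case: ex_minnP => k acck kmin.
  have kE : E (S k x) x.
    exists k => //; split; last by split=> //; move: acck; rewrite /accepts -ltNge.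
    move=> i ik; rewrite leNgt; apply/negP => acci.
    by have := kmin i; rewrite /accepts -ltNge => /(_ acci); rewrite leqNgt ik.
  rewrite (bigD1 (S k x)) //= indicE mem_set // mulr1 big1 ?addr0 //.
  move=> A AS; rewrite indicE memNset ?mulr0 // => -[j _ [rj [SA UA]]].
  (* If [A] were also first accepted, at pass [j], then [j < k] would contradict the minimality of
     [k], [k < j] the acceptance at [k], and [j = k] the choice of [A]. *)
  case: (ltngtP j k) => [jk|kj|jk].
  - by have := kmin j; rewrite /accepts SA -ltNge => /(_ UA); rewrite leqNgt jk.
  - by have := rj k kj; move: acck; rewrite /accepts => /negP.
  - by rewrite -SA jk eqxx in AS.
rewrite unlock; under eq_integral do rewrite outE -sumEFin.
rewrite integral_sum //; last first.
  move=> A; under eq_fun do rewrite EFinM.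
  by apply: integrableZl => //; exact: integrable_indic.
transitivity (\sum_A (v A * (uniform_pmf R N M A * q A / (c / Z)))%:E)%E.
  apply: eq_bigr => A _; under eq_integral do rewrite EFinM.
  rewrite integralZl //; last exact: integrable_indic.
  rewrite integral_indic // setIT EFinM -rateE; congr (_ * _)%E.
  by apply: accepted_prob.
rewrite sumEFin; congr (_%:E).
(* The inner sum is [p n] if [n] is in [A] and 0 otherwise, written so that [sum_committee]
   applies. *)
transitivity (Z * \sum_(A : {set 'I_N} | (#|A| == M) && good A)
    \sum_(m in A | m == n) p m).
  rewrite mulr_sumr [RHS]big_mkcond; apply: eq_bigr => A _.
  rewrite /uniform_pmf -/c /q; case: (#|A| == M); last by rewrite !mul0r mulr0.
  case: (good A) => /=; last by rewrite !mulr0 mul0r mulr0.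
  rewrite /v /voting_power /=; case: (boolP (n \in A)) => nA; last first.
    rewrite mul0r big_pred0 ?mulr0 // => m; apply/andP => -[mA /eqP mn].
    by rewrite -mn mA in nA.
  have -> : \sum_(m in A) (if m \in A then p m else 0) = \sum_(m in A) p m.
    by apply: eq_bigr => m ->.
  (* Membership of [n] makes the sum nonzero, so it cancels between [q A] and the denominator of the
     voting power. *)
  have pA0 : 0 < \sum_(m in A) p m.
    rewrite (bigD1 n) //= ltr_pwDl //.
    by apply: sumr_ge0 => m _; exact: ltW.
  rewrite [X in Z * X](big_pred1 n) => [|m]; last first.
    by rewrite /= andbC; case: eqP => [->|].
  by field; rewrite !gt_eqF.
by rewrite sum_committee big_pred1_eq pC mulrC divfK // gt_eqF.
Qed.
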